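(* Let $p$ be an odd prime, $g\ge 1$ an integer, and $m=(p-1)/2$. The following identities hold in $\mathbb{F}_p[z_1,\ldots,z_{2g-1}]$ for every $i$ with $1\le i\le g$. For every $j$ with $1\le j<g$, $$\left(\sum_{k=1}^{2g-1}z_k(z_k-1)\partial_k\right)c_{ip-j}=\left(m\sum_{k=1}^{2g-1}z_k+g-j\right)c_{ip-j}+(m-g+j+1)\,c_{ip-(j+1)}.$$ For all integers $r,s$ with $2\le r\le s<g$, $$\left(\sum_{k=1}^{2g-1}z_k^r(z_k-1)\partial_k\right)c_{ip-(s+1-r)}=m\sum_{\ell=1}^{r-1}\sum_{k=1}^{2g-1}z_k^{r-\ell}(z_k-1)\,c_{ip-(s+\ell-r)}+\left(m\sum_{k=1}^{2g-1}z_k+g-s\right)c_{ip-s}+(m-g+s+1)\,c_{ip-(s+1)}.$$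
   Context: Let $f(x)=x(x-1)(x-z_1)(x-z_2)\cdots(x-z_{2g-1})$ with $z_1,\ldots,z_{2g-1}$ indeterminates over $\mathbb{F}_p$. For an integer $k$, $c_k\in\mathbb{F}_p[z_1,\ldots,z_{2g-1}]$ denotes the coefficient of $x^k$ in $f(x)^{(p-1)/2}$ (so $c_k=0$ if $k<0$ or $k>(p-1)(2g+1)/2$). We write $\partial_k=\partial/\partial z_k$. Integers such as $g-j$ and $m-g+j+1$ are regarded as elements of $\mathbb{F}_p$. *)

(* Defs.v *)
From HB Require Import structures.
From mathcomp Require Import all_boot all_order all_algebra.
From mathcomp Require Import mpoly.
Set Implicit Arguments.
Unset Strict Implicit.
Unset Printing Implicit Defensive.
Import GRing.Theory.
Local Open Scope ring_scope.

(* Variables are indexed from 0: 'X_k, k : 'I_(2g-1), is z_(k+1); 'X is x. *)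
Definition fpoly (p g : nat) : {poly {mpoly 'F_p[2 * g - 1]}} :=
  'X * ('X - 1) * \prod_(k < 2 * g - 1) ('X - ('X_k)%:P).

(* The index is an integer because i * p - j can be negative. *)
Definition fcoef (p g : nat) (k : int) : {mpoly 'F_p[2 * g - 1]} :=
  match k with
  | Posz n => (fpoly p g ^+ (p - 1)./2)`_n
  | Negz _ => 0
  end.

(* Main.v *)
Require Import Defs.
From HB Require Import structures.
From mathcomp Require Import all_boot all_order all_algebra.
From mathcomp Require Import mpoly.
From mathcomp Require Import ring zify.
Set Implicit Arguments.
Unset Strict Implicit.
Unset Printing Implicit Defensive.
Import GRing.Theory.
Local Open Scope ring_scope.

(* The operator [d/dx + \sum_k d/dz_k] kills every [x - z_k], so it acts on
   [F = f^m] only through the factor [x(x - 1)], and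
   [x(x - 1)(F' + \sum_k d_k F) = m(2x - 1)F].  Since moreover
   [(x - z_k) d_k F = - m F], this expresses [\sum_k z_k(z_k - 1) d_k F] through
   [F] and [F'], and comparing coefficients of [x^(ip - j)] modulo [p], where
   [2m = -1], gives the first identity.  Coefficientwise, [(x - z_k) d_k F = - m F]
   reads [z_k d_k c_e = d_k c_(e-1) + m c_e]; iterating it reduces the second
   identity to the first. *)

(** * Logarithmic derivatives with cleared denominators *)

Section LogarithmicDerivative.

Variables (R : comNzRingType) (D : R -> R).
Hypothesis DM : forall a b, D (a * b) = D a * b + a * D b.

(** The relation [u * D a = s * a] stands for D(a)/a = s/u without division, so [s] adds over
    products. [D] is an abstract map with the Leibniz rule because it is instantiated both by [dz k]
    and by the operator [E] below. *)
Lemma logderivM u a b s t :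
  u * D a = s * a -> u * D b = t * b -> u * D (a * b) = (s + t) * (a * b).
Proof.
move=> Da Db; rewrite DM mulrDr mulrA Da mulrCA Db.
by ring.
Qed.

Lemma logderiv1 u : u * D 1 = 0 * 1.
Proof.
have := DM 1 1; rewrite !mulr1 mul1r -[LHS]addr0 => /addrI/esym->.
by rewrite mulr0.
Qed.

Lemma logderivX u a s n : u * D a = s * a -> u * D (a ^+ n) = (n%:R * s) * a ^+ n.
Proof.
move=> Da; elim: n => [|n IHn]; first by rewrite expr0 logderiv1 mulr0n !mul0r.
by rewrite exprS (logderivM Da IHn) -natr1; congr (_ * _); ring.
Qed.

Lemma logderiv_prod (I : Type) (r : seq I) u (a s : I -> R) :
  (forall l, u * D (a l) = s l * a l) ->
  u * D (\prod_(l <- r) a l) = (\sum_(l <- r) s l) * \prod_(l <- r) a l.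
Proof.
move=> Da; elim: r => [|l r IHr]; first by rewrite !big_nil logderiv1.
by rewrite !big_cons; apply: logderivM.
Qed.

End LogarithmicDerivative.

Section IntegerIndexedCoefficients.

Variable R : nzRingType.

(** The value 0 at negative indices makes multiplication by ['X] an index shift with no boundary
    case at 0, and matches [fcoef]. *)
Definition coefz (P : {poly R}) (e : int) : R :=
  if e is Posz n then P`_n else 0.

Lemma coefzD P Q e : coefz (P + Q) e = coefz P e + coefz Q e.
Proof. by case: e => n /=; rewrite ?coefD ?addr0. Qed.

Lemma coefzN P e : coefz (- P) e = - coefz P e.
Proof. by case: e => n /=; rewrite ?coefN ?oppr0. Qed.

Lemma coefzCM a P e : coefz (a%:P * P) e = a * coefz P e.
Proof. by case: e => n /=; rewrite ?coefCM ?mulr0. Qed.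

Lemma coefz_sum (I : Type) (r : seq I) (P : I -> {poly R}) e :
  coefz (\sum_(i <- r) P i) e = \sum_(i <- r) coefz (P i) e.
Proof. by case: e => n /=; rewrite ?coef_sum // big1. Qed.

Lemma coefzXM P e : coefz ('X * P) e = coefz P (e - 1).
Proof.
case: e => [[|n]|n] //; first by rewrite /= coefXM.
by rewrite [n.+1%:Z - 1]addrC intS addKr /= coefXM.
Qed.

Lemma coefz_Xderiv P e : coefz ('X * P^`()) e = e%:~R * coefz P e.
Proof.
case: e => [[|n]|n] /=; rewrite ?mulr0 // coefXM /= ?mul0r //.
by rewrite coef_deriv -mulr_natl.
Qed.

End IntegerIndexedCoefficients.

Section CoefficientwiseDerivative.

Variables (n : nat) (R : comNzRingType).
Implicit Types P Q : {poly {mpoly R[n]}}.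

Definition dz (k : 'I_n) P : {poly {mpoly R[n]}} := map_poly (mderiv k) P.

Lemma coef_dz k P e : (dz k P)`_e = (P`_e)^`M(k).
Proof. by rewrite coef_map_id0 ?mderiv0. Qed.

Lemma coefz_dz k P e : coefz (dz k P) e = (coefz P e)^`M(k).
Proof. by case: e => m /=; rewrite ?coef_dz ?mderiv0. Qed.

Lemma dzM k P Q : dz k (P * Q) = dz k P * Q + P * dz k Q.
Proof.
apply/polyP => e; rewrite coefD coef_dz !coefM raddf_sum -big_split /=.
by apply: eq_bigr => l _; rewrite mderivM !coef_dz.
Qed.

Lemma dzB k P Q : dz k (P - Q) = dz k P - dz k Q.
Proof. by apply/polyP => e; rewrite coefB !coef_dz coefB mderivB. Qed.

Lemma dzC k a : dz k a%:P = (a^`M(k))%:P.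
Proof. exact: map_polyC. Qed.

Lemma dz1 k : dz k 1 = 0.
Proof. by rewrite -polyC1 dzC mderivC polyC0. Qed.

Lemma dzX k : dz k 'X = 0.
Proof.
apply/polyP => e; rewrite coef_dz coefX coef0.
by case: (e == 1%N); rewrite ?mderiv0 // -mpolyC1 mderivC.
Qed.

Lemma dzXsubX k l : dz k ('X - ('X_l)%:P) = - (l == k)%:R%:P.
Proof.
rewrite dzB dzX dzC sub0r mderivX mnm1E.
case: eqP => [->|_]; last by rewrite mulr0n scale0r.
by rewrite -[U_(k)%MM in X in (X - _)%MM]add0m addmK mpolyX0 scale1r.
Qed.

End CoefficientwiseDerivative.

(** * Differential equations for the power of f and the resulting coefficient recurrences, over any
    commutative ring *)

Section HyperellipticPower.

Variables (n : nat) (R : comNzRingType) (m : nat).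
Let z (k : 'I_n) : {mpoly R[n]} := 'X_k.
Let f : {poly {mpoly R[n]}} := 'X * ('X - 1) * \prod_(k < n) ('X - (z k)%:P).
Let c := coefz (f ^+ m).

(** Among the factors of f only x - z_k involves z_k; it contributes -1/(x - z_k) to the logarithmic
    derivative, and the power multiplies this by m. *)
Lemma subX_dz_power k : ('X - (z k)%:P) * dz k (f ^+ m) = - m%:R * f ^+ m.
Proof.
pose u := 'X - (z k)%:P.
have LX : u * dz k 'X = 0 * 'X by rewrite dzX mulr0 mul0r.
have LX1 : u * dz k ('X - 1) = 0 * ('X - 1).
  by rewrite dzB dzX dz1 subr0 mulr0 mul0r.
have LXz l : u * dz k ('X - (z l)%:P) = - (l == k)%:R * ('X - (z l)%:P).
  rewrite dzXsubX; case: eqP => [->|_].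
    by rewrite polyC1 mulrN mulNr mulr1 mul1r.
  by rewrite polyC0 oppr0 mulr0 mul0r.
have DM := @dzM n R k.
have Lf := logderivM DM (logderivM DM LX LX1)
  (logderiv_prod DM (index_enum _) LXz).
rewrite (logderivX DM m Lf) !add0r -/f; congr (_ * _).
rewrite sumrN (bigD1 k) //= eqxx big1 ?addr0 ?mulrN ?mulr1 //.
by move=> l /negPf->.
Qed.

Lemma deriv_sum_dz_power :
  'X * ('X - 1) * ((f ^+ m)^`() + \sum_k dz k (f ^+ m))
  = m%:R * ('X * 2%:R - 1) * f ^+ m.
Proof.
pose E (P : {poly {mpoly R[n]}}) := P^`() + \sum_k dz k P.
have EM P Q : E (P * Q) = E P * Q + P * E Q.
  rewrite /E derivM (eq_bigr _ (fun k _ => dzM k P Q)) big_split /=.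
  by rewrite -mulr_suml -mulr_sumr; ring.
have EX : E 'X = 1 by rewrite /E derivX big1 ?addr0 // => k _; apply: dzX.
have EX1 : E ('X - 1) = 1.
  rewrite /E derivB derivX -polyC1 derivC subr0 big1 ?addr0 // => k _.
  by rewrite dzB dzX polyC1 dz1 subrr.
have EXz l : E ('X - (z l)%:P) = 0.
  rewrite /E derivB derivX derivC subr0 (bigD1 l) //= dzXsubX eqxx big1.
    by rewrite addr0 polyC1 subrr.
  by move=> k /negPf kl; rewrite dzXsubX eq_sym kl polyC0 oppr0.
pose u : {poly {mpoly R[n]}} := 'X * ('X - 1).
have LX : u * E 'X = ('X - 1) * 'X by rewrite EX mulr1 mulrC.
have LX1 : u * E ('X - 1) = 'X * ('X - 1) by rewrite EX1 mulr1.
have LXz l : u * E ('X - (z l)%:P) = 0 * ('X - (z l)%:P).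
  by rewrite EXz mulr0 mul0r.
have Lf := logderivM EM (logderivM EM LX LX1)
  (logderiv_prod EM (index_enum _) LXz).
rewrite -[LHS]/(u * E (f ^+ m)) (logderivX EM m Lf) -/f big1 //.
by congr (_ * _ * _); rewrite addr0; ring.
Qed.

(* [z(z - 1) = x(x - 1) - (x + z - 1)(x - z)] *)
Lemma sum_dz_power :
  \sum_k (z k * (z k - 1))%:P * dz k (f ^+ m)
  = - ('X * ('X * (f ^+ m)^`())) + 'X * (f ^+ m)^`()
    + (m * n.+2)%:R%:P * ('X * f ^+ m)
    + (m%:R * (\sum_k z k) - (m * n.+1)%:R)%:P * f ^+ m.
Proof.
have zE k : (z k * (z k - 1))%:P * dz k (f ^+ m)
    = 'X * ('X - 1) * dz k (f ^+ m)
      + m%:R * ('X - 1 + (z k)%:P) * f ^+ m.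
  transitivity ('X * ('X - 1) * dz k (f ^+ m)
      - ('X - 1 + (z k)%:P) * (('X - (z k)%:P) * dz k (f ^+ m))).
    by rewrite polyCM polyCB polyC1; ring.
  by rewrite subX_dz_power; ring.
rewrite (eq_bigr _ (fun k _ => zE k)) big_split /= -mulr_sumr -mulr_suml.
rewrite -mulr_sumr big_split /= sumr_const card_ord.
(* Replaces x(x - 1) times the sum of the d_k F by m(2x - 1)F - x(x - 1)F'. *)
have := deriv_sum_dz_power; rewrite mulrDr => /(canRL (addKr _)) ->.
rewrite -rmorph_sum !polyCB polyCM !polyC_natr !natrM -mulr_natl.
rewrite -[n.+2]addn2 -[n.+1]addn1 !natrD.
by ring.
Qed.

(** The coefficient of x^e in x F' is e c_e, and in x^2 F' it is (e - 1) c_(e-1); the latter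
    explains the term 1 - e in the last factor. *)
Lemma sum_mderiv_coefz e :
  \sum_k z k * (z k - 1) * (c e)^`M(k)
  = (m%:R * (\sum_k z k) + e%:~R - (m * n.+1)%:R) * c e
    + ((m * n.+2)%:R + 1 - e%:~R) * c (e - 1).
Proof.
have := congr1 (fun P => coefz P e) sum_dz_power.
rewrite coefz_sum !coefzD coefzN !coefzCM.
rewrite [coefz ('X * ('X * _)) _]coefzXM !coefz_Xderiv coefzXM -/c rmorphB /=.
under eq_bigr => k _ do rewrite coefzCM coefz_dz.
by move=> ->; rewrite -/c; ring.
Qed.

Lemma mulz_mderiv_coefz k e :
  z k * (c e)^`M(k) = (c (e - 1))^`M(k) + m%:R * c e.
Proof.
have := congr1 (fun P => coefz P e) (subX_dz_power k).
rewrite mulrBl -polyC_natr -polyCN coefzD coefzN !coefzCM coefzXM !coefz_dz -/c.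
by move=> /(canRL (subrK _)) ->; ring.
Qed.

(** Each factor z_k is traded for lowering the index of the differentiated coefficient by one, at
    the cost of one term without derivative. *)
Lemma expz_mderiv_coefz k t e :
  z k ^+ t * (c e)^`M(k)
  = (c (e - t%:Z))^`M(k) + m%:R * \sum_(l < t) z k ^+ (t - l.+1) * c (e - l%:Z).
Proof.
elim: t => [|t IHt] in e *.
  by rewrite big_ord0 subr0 mulr0 addr0 mul1r.
have eS l : e - 1 - l%:Z = e - l.+1%:Z by lia.
rewrite exprSr -mulrA mulz_mderiv_coefz mulrDr IHt eS -addrA; congr (_ + _).
rewrite [X in _ + X]mulrCA -mulrDr addrC big_ord_recl subr0 subn1.
by congr (_ * (_ + _)); apply: eq_bigr => l _; rewrite eS subSS.
Qed.

End HyperellipticPower.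

Theorem corollary3p6 (p g m : nat) (p_prime : prime p) (p_odd : odd p)
    (g_ge1 : (1 <= g)%N) (m_def : m = (p - 1)./2)
    (i : nat) (i_range : (1 <= i <= g)%N) :
  let c (k : int) := fcoef p g k in
  let z (k : 'I_(2 * g - 1)) : {mpoly 'F_p[2 * g - 1]} := 'X_k in
  (forall j : nat, (1 <= j < g)%N ->
     \sum_(k < 2 * g - 1)
        z k * (z k - 1) * (c (i%:Z * p%:Z - j%:Z))^`M(k)
     = (m%:R * (\sum_(k < 2 * g - 1) z k) + (g%:Z - j%:Z)%:~R)
         * c (i%:Z * p%:Z - j%:Z)
       + (m%:Z - g%:Z + j%:Z + 1)%:~R * c (i%:Z * p%:Z - (j%:Z + 1)))
  /\
  (forall r s : nat, (2 <= r)%N -> (r <= s)%N -> (s < g)%N ->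
     \sum_(k < 2 * g - 1)
        z k ^+ r * (z k - 1) * (c (i%:Z * p%:Z - (s%:Z + 1 - r%:Z)))^`M(k)
     = m%:R * (\sum_(1 <= l < r) \sum_(k < 2 * g - 1)
                 z k ^+ (r - l) * (z k - 1)
                   * c (i%:Z * p%:Z - (s%:Z + l%:Z - r%:Z)))
       + (m%:R * (\sum_(k < 2 * g - 1) z k) + (g%:Z - s%:Z)%:~R)
           * c (i%:Z * p%:Z - s%:Z)
       + (m%:Z - g%:Z + s%:Z + 1)%:~R * c (i%:Z * p%:Z - (s%:Z + 1))).
Proof.
move=> c z.
have cE e : c e = coefz (fpoly p g ^+ m) e by rewrite m_def.
have p0 : p%:R = 0 :> {mpoly 'F_p[2 * g - 1]}.
  by rewrite -mpolyC_nat pchar_Fp_0 // mpolyC0.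
have m2 : m%:R * 2%:R = -1 :> {mpoly 'F_p[2 * g - 1]}.
  apply/eqP; rewrite -addr_eq0 -natrM natr1 -p0 m_def.
  by rewrite (_ : (((p - 1)./2 * 2).+1 = p)%N) //; lia.
have part1 j : \sum_k z k * (z k - 1) * (c (i%:Z * p%:Z - j%:Z))^`M(k)
     = (m%:R * (\sum_k z k) + (g%:Z - j%:Z)%:~R) * c (i%:Z * p%:Z - j%:Z)
       + (m%:Z - g%:Z + j%:Z + 1)%:~R * c (i%:Z * p%:Z - (j%:Z + 1)).
  rewrite !cE [LHS](@sum_mderiv_coefz _ _ m) opprD addrA.
  (* With n = 2g - 1 and e = ip - j, modulo p: m(n + 1) = -g, m(n + 2) = m - g and e = -j. *)
  have n1 : (2 * g - 1).+1 = (2 * g)%N by lia.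
  have mg : (m * (2 * g))%:R = - g%:R :> {mpoly 'F_p[2 * g - 1]}.
    by rewrite mulnA !natrM m2 mulN1r.
  have eE : (i%:Z * p%:Z - j%:Z)%:~R = - j%:R :> {mpoly 'F_p[2 * g - 1]}.
    by rewrite rmorphB rmorphM /= -!pmulrn p0 mulr0 sub0r.
  rewrite n1 mulnS natrD mg eE !rmorphD !rmorphN /= -!pmulrn.
  by congr (_ * _ + _ * _); ring.
split=> [j _ | r s r_ge2 _ _]; first exact: part1.
set e := (_ - (s%:Z + 1 - r%:Z))%R.
have e_sub : e - (r.-1)%:Z = i%:Z * p%:Z - s%:Z by rewrite /e; lia.
(* One factor z_k stays with z_k - 1; the other r - 1 take the index from [e] to ip - s, where
   [part1] applies with j = s. *)
have step k : z k ^+ r * (z k - 1) * (c e)^`M(k)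
    = z k * (z k - 1) * (c (i%:Z * p%:Z - s%:Z))^`M(k)
      + m%:R * \sum_(1 <= l < r) z k ^+ (r - l) * (z k - 1)
                   * c (i%:Z * p%:Z - (s%:Z + l%:Z - r%:Z)).
  have := @expz_mderiv_coefz _ 'F_p m k r.-1 e.
  rewrite -/(fpoly p g) -!cE e_sub => zr.
  transitivity (z k * (z k - 1) * (z k ^+ r.-1 * (c e)^`M(k))).
    by rewrite -[in LHS](prednK (ltnW r_ge2)) exprS; ring.
  rewrite zr mulrDr; congr (_ + _).
  rewrite mulrCA big_distrr /=; congr (_ * _).
  (* The 0-based [l] stands for l + 1 in the stated sum; the retained z_k raises the exponent r - 1
     - (l + 1) to r - (l + 1). *)
  rewrite big_add1 big_mkord; apply: eq_bigr => l _.
  have rl : (r - l.+1 = (r.-1 - l.+1).+1)%N by have := ltn_ord l; lia.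
  rewrite -cE rl.
  rewrite exprS (_ : e - l%:Z = i%:Z * p%:Z - (s%:Z + l.+1%:Z - r%:Z)).
    by ring.
  by rewrite /e; lia.
rewrite (eq_bigr _ (fun k _ => step k)) big_split /= part1.
by rewrite -mulr_sumr exchange_big /= addrC addrA.
Qed.
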